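(* Every term of the un-typed symmetric $\lambda\mu$-calculus is strongly normalizing for the $\mu\mu'$-reduction, i.e. no term has an infinite sequence of $\mu\mu'$-reduction steps.
   Context: Terms of the symmetric $\lambda\mu$-calculus are given by $\mathcal{T} ::= x \mid \lambda x\,\mathcal{T}\mid(\mathcal{T}\;\mathcal{T})\mid\mu\alpha\,\mathcal{T}\mid(\alpha\;\mathcal{T})$, where $x,y,\dots$ are $\lambda$-variables and $\alpha,\beta,\dots$ are $\mu$-variables; $\lambda x$ and $\mu\alpha$ are binders, terms are considered up to renaming of bound variables and all substitutions are capture-avoiding. $M[\alpha=_rN]$ (resp. $M[\alpha=_lN]$) is obtained from $M$ by replacing (recursively) each sub-term of the form $(\alpha\;U)$ by $(\alpha\;(U\;N))$ (resp. $(\alpha\;(N\;U))$). The $\mu\mu'$-reduction is the closure under all term constructors of: $(\mu\alpha\,M\;N)\triangleright_\mu\mu\alpha\,M[\alpha=_rN]$ and $(N\;\mu\alpha\,M)\triangleright_{\mu'}\mu\alpha\,M[\alpha=_lN]$. *)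

(* Defs.v *)
(** The un-typed symmetric lambda-mu-calculus, up to alpha-conversion.

    Terms are in de Bruijn form with two separate families of indices, one
    for lambda-variables (bound by [Lam]) and one for mu-variables (bound by
    [Mu]); indices pointing beyond all enclosing binders of their family are
    free variables. *)
From Stdlib Require Import Arith.

Inductive term : Type :=
| Var (x : nat)
| Lam (M : term)
| App (M N : term)
| Mu (M : term)
| Named (a : nat) (M : term). (* (alpha M), where alpha is a mu-variable *)

Definition up (xi : nat -> nat) (n : nat) : nat :=
  match n with
  | O => O
  | S m => S (xi m)
  end.

(** Renaming: [xi] acts on lambda-variables and [zeta] on mu-variables. *)
Fixpoint rename (xi zeta : nat -> nat) (M : term) : term :=
  match M with
  | Var x => Var (xi x)
  | Lam P => Lam (rename (up xi) zeta P)
  | App P Q => App (rename xi zeta P) (rename xi zeta Q)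
  | Mu P => Mu (rename xi (up zeta) P)
  | Named a P => Named (zeta a) (rename xi zeta P)
  end.

Definition shift_lam : term -> term := rename S (fun a => a).
Definition shift_mu : term -> term := rename (fun x => x) S.

Inductive side : Type := lft | rgt.

Definition apply_on (s : side) (U N : term) : term :=
  match s with
  | rgt => App U N
  | lft => App N U
  end.

(** [subst_mu rgt a N M] is [M[a =_r N]] and [subst_mu lft a N M] is
    [M[a =_l N]]. The name [a] is kept, and shifting [N] under each
    binder is what makes the substitution capture-avoiding. *)
Fixpoint subst_mu (s : side) (a : nat) (N M : term) : term :=
  match M with
  | Var x => Var x
  | Lam P => Lam (subst_mu s a (shift_lam N) P)
  | App P Q => App (subst_mu s a N P) (subst_mu s a N Q)
  | Mu P => Mu (subst_mu s (S a) (shift_mu N) P)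
  | Named b U =>
      if Nat.eqb b a then Named b (apply_on s (subst_mu s a N U) N)
      else Named b (subst_mu s a N U)
  end.

(** In the two base rules the index of the bound mu-variable is 0 in [M], and
    [N] moves under the binder [Mu]. *)
Inductive step : term -> term -> Prop :=
| step_mu M N : step (App (Mu M) N) (Mu (subst_mu rgt 0 (shift_mu N) M))
| step_mu' M N : step (App N (Mu M)) (Mu (subst_mu lft 0 (shift_mu N) M))
| step_lam M M' : step M M' -> step (Lam M) (Lam M')
| step_app_l M M' N : step M M' -> step (App M N) (App M' N)
| step_app_r M N N' : step N N' -> step (App M N) (App M N')
| step_under_mu M M' : step M M' -> step (Mu M) (Mu M')
| step_named a M M' : step M M' -> step (Named a M) (Named a M').

Definition strongly_normalizing (R : term -> term -> Prop) (M : term) : Prop :=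
  ~ exists f : nat -> term, f 0 = M /\ forall n : nat, R (f n) (f (S n)).

(* Main.v *)
(** The point is that [M] and [N] strongly normalizing imply [App M N] strongly
    normalizing. Order terms by the transitive closure of "reduct or subterm",
    which is well-founded below a strongly normalizing term, and consider
    simultaneous substitutions [k] sending a mu-name to a side and an argument.
    By recursion on [U], call [k] good for [U] if applying [U'[k']] to an argument
    of [k] is strongly normalizing whenever [U'] is smaller than [U] and [k'] is
    good for [U']. If [k] is good for [U], then [U[k]] is strongly normalizing: a
    substitution does not create head [Mu]s, so the only new redexes sit below
    names, where goodness applies. Finally [App (U[k]) (V[k'])] is strongly
    normalizing for good [k], [k'], by induction on the pair [U], [V]: a head
    reduction requires say that [U] reduces to [Mu U1], and gives [U1] under [k]
    extended by [V[k']], which is good for [U1] by the induction hypothesis for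
    the pairs [U'], [V] with [U'] smaller than [U1]. *)
Require Import Defs.
From Stdlib Require Import List Relations Wellfounded.
Import ListNotations.

(** * Simultaneous substitution *)

Definition map_args (f : term -> term) (l : list (side * term)) :=
  map (fun p => (fst p, f (snd p))) l.

Definition fill (l : list (side * term)) (T : term) : term :=
  fold_left (fun T p => apply_on (fst p) T (snd p)) l T.

(* [extend [] k] is [k] pushed under a [Mu]. *)
Definition extend (l : list (side * term)) (k : nat -> list (side * term)) (a : nat) :=
  match a with
  | O => l
  | S b => map_args shift_mu (k b)
  end.

(* The arguments [k a] are lists, not single arguments, so that substitutions
   compose; renamings and [subst_mu] are special cases. *)
Fixpoint sub (xi zeta : nat -> nat) (k : nat -> list (side * term)) (M : term)
  : term :=
  match M with
  | Var x => Var (xi x)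
  | Lam P => Lam (sub (up xi) zeta (fun a => map_args shift_lam (k a)) P)
  | App P Q => App (sub xi zeta k P) (sub xi zeta k Q)
  | Mu P => Mu (sub xi (up zeta) (extend [] k) P)
  | Named a P => Named (zeta a) (fill (k a) (sub xi zeta k P))
  end.

Definition single (s : side) (a : nat) (N : term) (b : nat) :=
  if Nat.eqb b a then [(s, N)] else [].

Lemma map_args_ext f g l : (forall M, f M = g M) -> map_args f l = map_args g l.
Proof. intros H; apply map_ext; intros [s M]; simpl; now rewrite H. Qed.

Lemma map_args_map f g l :
  map_args f (map_args g l) = map_args (fun M => f (g M)) l.
Proof. apply map_map. Qed.

Lemma map_args_app f l l' : map_args f (l ++ l') = map_args f l ++ map_args f l'.
Proof. apply map_app. Qed.

Lemma map_args_id f l : (forall M, f M = M) -> map_args f l = l.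
Proof.
  intros H; induction l as [|[s M] l IH]; simpl; [easy|now rewrite H, IH].
Qed.

Lemma fill_app l l' T : fill (l ++ l') T = fill l' (fill l T).
Proof. apply fold_left_app. Qed.

Lemma sub_fill xi zeta k l T :
  sub xi zeta k (fill l T) = fill (map_args (sub xi zeta k) l) (sub xi zeta k T).
Proof.
  revert T; induction l as [|[[] N] l IH]; intros T; simpl; try rewrite IH; easy.
Qed.

Lemma sub_ext xi xi' zeta zeta' k k' M :
  (forall x, xi x = xi' x) -> (forall a, zeta a = zeta' a) ->
  (forall a, k a = k' a) -> sub xi zeta k M = sub xi' zeta' k' M.
Proof.
  revert xi xi' zeta zeta' k k'.
  induction M as [x|M IH|M IHM N IHN|M IH|a M IH];
    intros xi xi' zeta zeta' k k' Hx Hz Hk; simpl; f_equal; auto.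
  - apply IH; auto; [intros []; simpl; auto|intros a; now rewrite Hk].
  - apply IH; auto; intros []; simpl; auto; now rewrite Hk.
  - now rewrite Hk, (IH xi xi' zeta zeta' k k').
Qed.

Lemma rename_sub_nil xi zeta M : rename xi zeta M = sub xi zeta (fun _ => []) M.
Proof.
  revert xi zeta; induction M; intros xi zeta; simpl; f_equal; auto.
  rewrite IHM; apply sub_ext; auto; now intros [].
Qed.

Lemma subst_mu_sub s a N M :
  subst_mu s a N M = sub (fun x => x) (fun b => b) (single s a N) M.
Proof.
  revert a N; induction M as [x|M IH|M1 IH1 M2 IH2|M IH|b M IH];
    intros a N; simpl; f_equal; auto.
  - rewrite IH; apply sub_ext; auto; [now intros []|].
    intros b; unfold single; now destruct (Nat.eqb b a).
  - rewrite IH; apply sub_ext; auto; [now intros []|].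
    intros [|b]; simpl; auto. unfold single; simpl; now destruct (Nat.eqb b a).
  - rewrite IH; change (single s a N b) with (if Nat.eqb b a then [(s, N)] else []).
    now destruct (Nat.eqb b a).
Qed.

Lemma rename_id M : rename (fun x => x) (fun a => a) M = M.
Proof.
  assert (H : forall xi zeta, (forall x, xi x = x) -> (forall a, zeta a = a) ->
    rename xi zeta M = M); [|now apply H].
  induction M; intros xi zeta Hx Hz; simpl; f_equal; auto;
    apply IHM; auto; intros []; simpl; auto.
Qed.

Lemma sub_rename xi zeta k xi' zeta' M :
  sub xi zeta k (rename xi' zeta' M) =
  sub (fun x => xi (xi' x)) (fun a => zeta (zeta' a)) (fun a => k (zeta' a)) M.
Proof.
  revert xi zeta k xi' zeta'; induction M; intros xi zeta k xi' zeta';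
    simpl; f_equal; auto.
  - rewrite IHM; apply sub_ext; auto; now intros [].
  - rewrite IHM; apply sub_ext; auto; now intros [].
  - now rewrite IHM.
Qed.

Lemma rename_rename xi zeta xi' zeta' M :
  rename xi zeta (rename xi' zeta' M) =
  rename (fun x => xi (xi' x)) (fun a => zeta (zeta' a)) M.
Proof. now rewrite rename_sub_nil, sub_rename, <- rename_sub_nil. Qed.

Lemma rename_fill xi zeta l T :
  rename xi zeta (fill l T) = fill (map_args (rename xi zeta) l) (rename xi zeta T).
Proof.
  rewrite !rename_sub_nil, sub_fill; f_equal.
  apply map_args_ext; intros M; symmetry; apply rename_sub_nil.
Qed.

Lemma rename_sub xi zeta xi' zeta' k M :
  rename xi zeta (sub xi' zeta' k M) =
  sub (fun x => xi (xi' x)) (fun a => zeta (zeta' a))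
    (fun a => map_args (rename xi zeta) (k a)) M.
Proof.
  revert xi zeta xi' zeta' k; induction M; intros xi zeta xi' zeta' k;
    simpl; f_equal; auto.
  - rewrite IHM; apply sub_ext; auto; [now intros []|].
    intros a; rewrite !map_args_map; apply map_args_ext; intros N.
    unfold shift_lam; now rewrite !rename_rename.
  - rewrite IHM; apply sub_ext; auto; [now intros []|].
    intros [|a]; simpl; auto; rewrite !map_args_map; apply map_args_ext; intros N.
    unfold shift_mu; now rewrite !rename_rename.
  - now rewrite rename_fill, IHM.
Qed.

Lemma sub_up_shift_mu xi zeta k M :
  sub xi (up zeta) (extend [] k) (shift_mu M) = shift_mu (sub xi zeta k M).
Proof. unfold shift_mu; rewrite sub_rename, rename_sub; now apply sub_ext. Qed.

Lemma sub_up_shift_lam xi zeta k M :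
  sub (up xi) zeta (fun a => map_args shift_lam (k a)) (shift_lam M) =
  shift_lam (sub xi zeta k M).
Proof. unfold shift_lam; rewrite sub_rename, rename_sub; now apply sub_ext. Qed.

(** The inner substitution wraps the body of a name first, so its arguments come first in the
    combined list. *)
Lemma sub_sub xi zeta k xi' zeta' k' M :
  sub xi zeta k (sub xi' zeta' k' M) =
  sub (fun x => xi (xi' x)) (fun a => zeta (zeta' a))
    (fun a => map_args (sub xi zeta k) (k' a) ++ k (zeta' a)) M.
Proof.
  revert xi zeta k xi' zeta' k'; induction M; intros xi zeta k xi' zeta' k';
    simpl; f_equal; auto.
  - rewrite IHM; apply sub_ext; auto; [now intros []|].
    intros a; rewrite map_args_app, !map_args_map; f_equal.
    apply map_args_ext; intros N; apply sub_up_shift_lam.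
  - rewrite IHM; apply sub_ext; auto; [now intros []|].
    intros [|a]; simpl; auto; rewrite map_args_app, !map_args_map; f_equal.
    apply map_args_ext; intros N; apply sub_up_shift_mu.
  - now rewrite sub_fill, IHM, fill_app.
Qed.

Lemma sub_id M : sub (fun x => x) (fun a => a) (fun _ => []) M = M.
Proof. now rewrite <- rename_sub_nil, rename_id. Qed.

Lemma subst_mu_shift s N M : subst_mu s 0 N (shift_mu M) = shift_mu M.
Proof.
  rewrite subst_mu_sub; unfold shift_mu; rewrite sub_rename.
  now rewrite (rename_sub_nil _ S).
Qed.

(** Index 0 is absent from the shifted arguments, so substituting for it afterwards only fills the
    empty list at 0. The contractum of a substituted [Mu] thus becomes one simultaneous
    substitution. *)
Lemma subst_mu_sub_up s N xi zeta k M :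
  subst_mu s 0 (shift_mu N) (sub xi (up zeta) (extend [] k) M) =
  sub xi (up zeta) (extend [(s, shift_mu N)] k) M.
Proof.
  rewrite subst_mu_sub, sub_sub; apply sub_ext; auto.
  intros [|a]; simpl; auto.
  rewrite app_nil_r, map_args_map; apply map_args_ext; intros M'.
  rewrite <- subst_mu_sub; apply subst_mu_shift.
Qed.

Lemma sub_subst_mu s N xi zeta k M :
  sub xi (up zeta) (extend [] k) (subst_mu s 0 (shift_mu N) M) =
  subst_mu s 0 (shift_mu (sub xi zeta k N)) (sub xi (up zeta) (extend [] k) M).
Proof.
  rewrite subst_mu_sub_up, subst_mu_sub, sub_sub; apply sub_ext; auto.
  intros [|a]; simpl; auto.
  now rewrite sub_up_shift_mu.
Qed.

(** * Reduction *)

Definition steps := clos_refl_trans_1n term step.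
Notation SN := (Acc (fun N M => step M N)).

Lemma steps_trans M N P : steps M N -> steps N P -> steps M P.
Proof.
  induction 1; intros; [easy|]; econstructor; eauto; now apply IHclos_refl_trans_1n.
Qed.

Lemma steps_map (f : term -> term) :
  (forall M N, step M N -> step (f M) (f N)) ->
  forall M N, steps M N -> steps (f M) (f N).
Proof. intros Hf M N; induction 1; [constructor|]; econstructor; eauto. Qed.

Lemma steps_app M M' N N' : steps M M' -> steps N N' -> steps (App M N) (App M' N').
Proof.
  intros H1 H2; apply steps_trans with (App M' N).
  - apply (steps_map (fun T => App T N)); [now constructor|easy].
  - apply (steps_map (fun T => App M' T)); [now constructor|easy].
Qed.

Lemma step_redex s M N :
  step (apply_on s (Mu M) N) (Mu (subst_mu s 0 (shift_mu N) M)).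
Proof. destruct s; simpl; constructor. Qed.

Lemma step_apply_on s M M' N : step M M' -> step (apply_on s M N) (apply_on s M' N).
Proof. destruct s; simpl; now constructor. Qed.

Lemma steps_apply_on s M M' N N' :
  steps M M' -> steps N N' -> steps (apply_on s M N) (apply_on s M' N').
Proof. destruct s; simpl; intros; now apply steps_app. Qed.

Lemma SN_steps M N : SN M -> steps M N -> SN N.
Proof. intros H; induction 1; auto; apply IHclos_refl_trans_1n; now apply H. Qed.

Lemma SN_Lam M : SN M -> SN (Lam M).
Proof. induction 1; constructor; intros T HT; inversion HT; subst; auto. Qed.

Lemma SN_Mu M : SN M -> SN (Mu M).
Proof. induction 1; constructor; intros T HT; inversion HT; subst; auto. Qed.

Lemma SN_Named a M : SN M -> SN (Named a M).
Proof. induction 1; constructor; intros T HT; inversion HT; subst; auto. Qed.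

Lemma SN_Var x : SN (Var x).
Proof. constructor; intros T HT; inversion HT. Qed.

(** A head contraction needs [M] or [N] to be a [Mu]. The last two premises range over all reducts,
    so that they are inherited in the nested induction on [M] and [N]. *)
Lemma SN_App M N :
  SN M -> SN N ->
  (forall M1 N', steps M (Mu M1) -> steps N N' ->
     SN (subst_mu rgt 0 (shift_mu N') M1)) ->
  (forall M' N1, steps M M' -> steps N (Mu N1) ->
     SN (subst_mu lft 0 (shift_mu M') N1)) ->
  SN (App M N).
Proof.
  intros HM; revert N; induction HM as [M _ IHM].
  intros N HN; induction HN as [N HN IHN].
  intros Hr Hl; constructor; intros T HT; inversion HT; subst.
  - apply SN_Mu, Hr; constructor.
  - apply SN_Mu, Hl; constructor.
  - apply IHM; auto; [now constructor| |]; intros; [apply Hr|apply Hl]; auto;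
      econstructor; eauto.
  - apply IHN; auto; intros; [apply Hr|apply Hl]; auto; econstructor; eauto.
Qed.

(** * Compatibility of reduction with substitution *)

Lemma step_fill l M N : step M N -> step (fill l M) (fill l N).
Proof.
  revert M N; induction l as [|[s P] l IH]; simpl; intros M N H; auto.
  now apply IH, step_apply_on.
Qed.

Lemma step_sub M N : step M N ->
  forall xi zeta k, step (sub xi zeta k M) (sub xi zeta k N).
Proof.
  induction 1; intros xi zeta k; simpl; try (constructor; auto using step_fill; fail).
  - rewrite sub_subst_mu; constructor.
  - rewrite sub_subst_mu; constructor.
Qed.

Lemma steps_rename xi zeta M N :
  steps M N -> steps (rename xi zeta M) (rename xi zeta N).
Proof.
  apply steps_map; intros; rewrite !rename_sub_nil; now apply step_sub.
Qed.

Lemma steps_subst_mu s a P M N :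
  steps M N -> steps (subst_mu s a P M) (subst_mu s a P N).
Proof.
  apply (steps_map (subst_mu s a P)); intros; rewrite !subst_mu_sub; now apply step_sub.
Qed.

(** The argument may be copied or erased, so even a single step of it can become any number of
    steps. *)
Lemma steps_subst_mu_arg s a P Q M :
  steps P Q -> steps (subst_mu s a P M) (subst_mu s a Q M).
Proof.
  revert a P Q; induction M; intros b P Q H; simpl.
  - constructor.
  - apply (steps_map Lam); [apply step_lam|]; now apply IHM, steps_rename.
  - now apply steps_app; auto.
  - apply (steps_map Mu); [apply step_under_mu|]; now apply IHM, steps_rename.
  - destruct (Nat.eqb a b); apply (steps_map (Named a)); try apply step_named; auto.
    apply steps_apply_on; auto.
Qed.

(** An application becomes a [Mu] only through a head contraction. Earlier steps in the argument are
    postponed and performed in its copies, so the contractum contains the argument unreduced. *)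
Lemma steps_Mu_inv T W : steps T (Mu W) ->
  match T with
  | Mu P => steps P W
  | App P Q =>
      (exists X, steps P (Mu X) /\ steps (subst_mu rgt 0 (shift_mu Q) X) W) \/
      (exists X, steps Q (Mu X) /\ steps (subst_mu lft 0 (shift_mu P) X) W)
  | _ => False
  end.
Proof.
  intros H; remember (Mu W) as V eqn:E; induction H as [|T T' V HT _ IH].
  - subst; constructor.
  - specialize (IH E); destruct HT; try easy.
    + left; exists M; split; [constructor|easy].
    + right; exists M; split; [constructor|easy].
    + destruct IH as [(X & H1 & H2)|(X & H1 & H2)]; [left|right]; exists X; split; auto.
      * econstructor; eauto.
      * eapply steps_trans; eauto; apply steps_subst_mu_arg, steps_rename.
        econstructor; eauto; constructor.
    + destruct IH as [(X & H1 & H2)|(X & H1 & H2)]; [left|right]; exists X; split; auto.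
      * eapply steps_trans; eauto; apply steps_subst_mu_arg, steps_rename.
        econstructor; eauto; constructor.
      * econstructor; eauto.
    + econstructor; eauto.
Qed.

(* [sub] only acts below names, so it cannot create a head [Mu]. *)
Lemma steps_sub_Mu_inv U xi zeta k W :
  steps (sub xi zeta k U) (Mu W) ->
  exists U1, steps U (Mu U1) /\ steps (sub xi (up zeta) (extend [] k) U1) W.
Proof.
  revert xi zeta k W; induction U as [x|P IHP|P IHP Q IHQ|P IHP|a P IHP];
    intros xi zeta k W H; apply steps_Mu_inv in H; simpl in H; try easy.
  - destruct H as [(X & H1 & H2)|(X & H1 & H2)].
    + apply IHP in H1 as (P1 & HP & HX).
      exists (subst_mu rgt 0 (shift_mu Q) P1); split.
      * apply steps_trans with (App (Mu P1) Q); [apply steps_app; [easy|constructor]|].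
        econstructor; [constructor|constructor].
      * rewrite sub_subst_mu; eapply steps_trans; eauto; now apply steps_subst_mu.
    + apply IHQ in H1 as (Q1 & HQ & HX).
      exists (subst_mu lft 0 (shift_mu P) Q1); split.
      * apply steps_trans with (App P (Mu Q1)); [apply steps_app; [constructor|easy]|].
        econstructor; [constructor|constructor].
      * rewrite sub_subst_mu; eapply steps_trans; eauto; now apply steps_subst_mu.
  - exists P; split; [constructor|easy].
Qed.

(** * The order generated by reduction and subterms *)

Inductive subterm : term -> term -> Prop :=
| subterm_lam M : subterm M (Lam M)
| subterm_app_l M N : subterm M (App M N)
| subterm_app_r M N : subterm N (App M N)
| subterm_mu M : subterm M (Mu M)
| subterm_named a M : subterm M (Named a M).

Definition smaller (N M : term) : Prop := subterm N M \/ step M N.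
Definition lt := clos_trans term smaller.

Lemma subterm_step N M N' :
  clos_refl_trans_1n term subterm N M -> step N N' ->
  exists M', step M M' /\ clos_refl_trans_1n term subterm N' M'.
Proof.
  intros H; revert N'; induction H as [N|N P M HN _ IH]; intros N' HN'.
  - exists N'; split; [easy|constructor].
  - assert (HP : exists P', step P P' /\ subterm N' P')
      by (destruct HN; eexists; (split; [|constructor]); constructor; exact HN').
    destruct HP as (P' & HP & HN'').
    destruct (IH _ HP) as (M' & ? & ?); exists M'; split; auto.
    econstructor; eauto.
Qed.

(** Induction on the reduction of [M], then on the structure of its subterm [N]: a reduct of [N] is
    a subterm of a reduct of [M], and an immediate subterm of [N] is still a subterm of [M]. *)
Lemma SN_Acc_lt M : SN M -> Acc lt M.
Proof.
  intros H; apply Acc_clos_trans; induction H as [M _ IH].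
  enough (E : forall N, clos_refl_trans_1n term subterm N M -> Acc smaller N)
    by (apply E; constructor).
  assert (Hdown : forall P N, Acc smaller P ->
    clos_refl_trans_1n term subterm N P -> Acc smaller N).
  { intros P N HP HN; revert HP; induction HN; auto; intros HP.
    apply (Acc_inv (IHHN HP)); now left. }
  intros N; induction N as [x|N IHN|N1 IHN1 N2 IHN2|N IHN|a N IHN];
    intros HN; constructor; intros T [HT|HT];
    try (destruct (subterm_step _ _ _ HN HT) as (M' & HM & HT');
         exact (Hdown M' T (IH M' HM) HT'));
    assert (HTM := Relation_Operators.rt1n_trans _ _ _ _ _ HT HN);
    inversion HT; subst; auto.
Qed.

Lemma lt_subterm N M : subterm N M -> lt N M.
Proof. intros; apply t_step; now left. Qed.

Lemma lt_trans N M P : lt N M -> lt M P -> lt N P.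
Proof. apply t_trans. Qed.

Lemma steps_lt M N P : steps M N -> lt P N -> lt P M.
Proof.
  induction 1 as [|M M1 N HM _ IH]; auto; intros HP.
  apply lt_trans with M1; [now apply IH|]; apply t_step; now right.
Qed.

Lemma steps_subst_lt s P Q P1 :
  steps P (Mu P1) -> lt (subst_mu s 0 (shift_mu Q) P1) (apply_on s P Q).
Proof.
  intros H; apply steps_lt with (Mu (subst_mu s 0 (shift_mu Q) P1)).
  - eapply steps_trans; [apply steps_apply_on; [eauto|constructor]|].
    econstructor; [apply step_redex|constructor].
  - apply lt_subterm; constructor.
Qed.

(** * Admissible substitutions *)

(* Quantifying over all renamings of the arguments makes goodness stable under
   pushing [k] below binders. *)
Fixpoint good (U : term) (h : Acc lt U) (k : nat -> list (side * term)) {struct h}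
  : Prop :=
  forall a U' (l : lt U' U) xi zeta k',
    good U' (Acc_inv h l) k' ->
    forall xi' zeta',
      SN (fill (map_args (rename xi' zeta') (k a)) (sub xi zeta k' U')).

(** [good] occurs to the left of an arrow in its own definition, so the induction hypothesis is used
    from [h2] back to [h1]; a third proof [h] drives the induction to allow this. *)
Lemma good_irrelevant U (h : Acc lt U) :
  forall h1 h2 k, good U h1 k -> good U h2 k.
Proof.
  induction h as [U _ IH]; intros [h1] [h2] k H; simpl in *.
  intros a U' l xi zeta k' Hk'; apply (H a U' l); eapply IH; eauto.
Qed.

Lemma good_unfold U h k :
  good U h k <->
  forall a U' (h' : Acc lt U') xi zeta k',
    lt U' U -> good U' h' k' ->
    forall xi' zeta',
      SN (fill (map_args (rename xi' zeta') (k a)) (sub xi zeta k' U')).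
Proof.
  destruct h as [h]; simpl; split; intros H a U'.
  - intros h' xi zeta k' l Hk'; apply (H a U' l); eapply good_irrelevant; eauto.
  - intros l xi zeta k' Hk'; eapply H; eauto.
Qed.

Lemma good_lt U h k U' h' : lt U' U -> good U h k -> good U' h' k.
Proof.
  intros l H; apply good_unfold; intros; eapply good_unfold; eauto using lt_trans.
Qed.

Lemma good_rename U h k xi zeta :
  good U h k -> good U h (fun a => map_args (rename xi zeta) (k a)).
Proof.
  intros H; apply good_unfold; intros a U' h' x z k' l Hk' xi' zeta'.
  rewrite map_args_map.
  rewrite (map_args_ext _ (rename (fun x => xi' (xi x)) (fun a => zeta' (zeta a))));
    [|intros; apply rename_rename].
  eapply (proj1 (good_unfold _ _ _) H); eauto.
Qed.

Lemma good_extend U h l k :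
  good U h k ->
  (forall U' (h' : Acc lt U') xi zeta k', lt U' U -> good U' h' k' ->
     forall xi' zeta',
       SN (fill (map_args (rename xi' zeta') l) (sub xi zeta k' U'))) ->
  good U h (extend l k).
Proof.
  intros Hk Hl; apply good_unfold; intros [|a] U' h' xi zeta k' lt' Hk' xi' zeta'.
  - eapply Hl; eauto.
  - eapply (proj1 (good_unfold _ _ _) (good_rename _ _ _ (fun x => x) S Hk) a); eauto.
Qed.

Lemma good_sub_SN U h xi zeta k : good U h k -> SN (sub xi zeta k U).
Proof.
  assert (HU := h); revert h xi zeta k; induction HU as [U H IH].
  (* The list at 0 is empty, so its test is the induction hypothesis itself. *)
  assert (Hup : forall T h h' k, lt T U -> good U h k -> good T h' (extend [] k)).
  { intros T h h' k l Hk; apply good_extend; [eapply good_lt; eauto|].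
    simpl; intros; eapply IH; eauto using lt_trans. }
  intros h xi zeta k Hk; destruct U as [x|P|P Q|P|a P]; simpl.
  - apply SN_Var.
  - assert (l : lt P (Lam P)) by (apply lt_subterm; constructor).
    apply SN_Lam, (IH P l (H P l)), good_rename; eapply good_lt; eauto.
  - assert (lP : lt P (App P Q)) by (apply lt_subterm; constructor).
    assert (lQ : lt Q (App P Q)) by (apply lt_subterm; constructor).
    apply SN_App.
    + apply (IH P lP (H P lP)); eapply good_lt; eauto.
    + apply (IH Q lQ (H Q lQ)); eapply good_lt; eauto.
    (* The head [Mu] comes from a reduct [Mu P1] of [P], so the body of the contractum is the image
       of a term below [App P Q]. *)
    + intros M1 N' HM HN; apply steps_sub_Mu_inv in HM as (P1 & HP & HM).
      apply (steps_subst_lt rgt P Q) in HP.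
      apply SN_steps with (subst_mu rgt 0 (shift_mu (sub xi zeta k Q))
                             (sub xi (up zeta) (extend [] k) P1)).
      * rewrite <- sub_subst_mu; eapply (IH _ HP (H _ HP)), Hup; eauto.
      * eapply steps_trans; [apply steps_subst_mu; eauto|].
        now apply steps_subst_mu_arg, steps_rename.
    + intros M' N1 HM HN; apply steps_sub_Mu_inv in HN as (Q1 & HQ & HN).
      apply (steps_subst_lt lft Q P) in HQ.
      apply SN_steps with (subst_mu lft 0 (shift_mu (sub xi zeta k P))
                             (sub xi (up zeta) (extend [] k) Q1)).
      * rewrite <- sub_subst_mu; eapply (IH _ HQ (H _ HQ)), Hup; eauto.
      * eapply steps_trans; [apply steps_subst_mu; eauto|].
        now apply steps_subst_mu_arg, steps_rename.
  - assert (l : lt P (Mu P)) by (apply lt_subterm; constructor).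
    apply SN_Mu, (IH P l (H P l)); eapply Hup; eauto.
  - assert (l : lt P (Named a P)) by (apply lt_subterm; constructor).
    apply SN_Named.
    (* Goodness speaks of renamed arguments, hence the identity renaming. *)
    rewrite <- (map_args_id (rename (fun x => x) (fun a => a)) (k a) rename_id).
    eapply (proj1 (good_unfold _ _ _) Hk a P (H P l)); auto.
    eapply good_lt; eauto.
Qed.

(** * Strong normalization of applications and of all terms *)

(** Reducts [A], [B] and arbitrary renamings and substitutions let the induction hypotheses absorb
    the steps made before a head contraction and the renamings in the tests of goodness. *)
Lemma good_App U V hU hV :
  forall xi zeta k xi' zeta' k' A B,
  good U hU k -> good V hV k' ->
  steps (sub xi zeta k U) A -> steps (sub xi' zeta' k' V) B -> SN (App A B).
Proof.
  assert (HU := hU); assert (HV := hV); revert V hU hV HV.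
  induction HU as [U _ IHU]; intros V hU hV HV; revert hU hV.
  induction HV as [V _ IHV].
  intros hU hV xi zeta k xi' zeta' k' A B Hk Hk' HA HB.
  apply SN_App.
  - exact (SN_steps _ _ (good_sub_SN _ _ _ _ _ Hk) HA).
  - exact (SN_steps _ _ (good_sub_SN _ _ _ _ _ Hk') HB).
  - intros W B' HW HB'.
    destruct (steps_sub_Mu_inv _ _ _ _ _ (steps_trans _ _ _ HA HW)) as (U1 & HU1 & HW1).
    apply SN_steps with (subst_mu rgt 0 (shift_mu B') (sub xi (up zeta) (extend [] k) U1));
      [|now apply steps_subst_mu].
    assert (l : lt U1 U)
      by (eapply steps_lt; [eauto|]; apply lt_subterm; constructor).
    rewrite subst_mu_sub_up; apply good_sub_SN with (h := Acc_inv hU l).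
    apply good_extend; [eapply good_lt; eauto|].
    (* The test applies a smaller [U'] to a renaming of [B'], which is a reduct of [V] under the
       renamed [k']: the outer hypothesis for [U'] and [V]. *)
    intros U' h' x z k'' l' Hk'' x' z'; simpl; unfold shift_mu; rewrite rename_rename.
    refine (IHU U' (lt_trans _ _ _ l' l) V h' hV hV x z k'' _ _ _ _ _
              Hk'' (good_rename _ _ _ _ _ Hk') _ _); [constructor|].
    rewrite <- rename_sub; apply steps_rename; eapply steps_trans; eauto.
  - intros A' W HA' HW.
    destruct (steps_sub_Mu_inv _ _ _ _ _ (steps_trans _ _ _ HB HW)) as (V1 & HV1 & HW1).
    apply SN_steps with
      (subst_mu lft 0 (shift_mu A') (sub xi' (up zeta') (extend [] k') V1));
      [|now apply steps_subst_mu].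
    assert (l : lt V1 V)
      by (eapply steps_lt; [eauto|]; apply lt_subterm; constructor).
    rewrite subst_mu_sub_up; apply good_sub_SN with (h := Acc_inv hV l).
    apply good_extend; [eapply good_lt; eauto|].
    (* Here [U] is kept and [V'] is smaller, so the inner hypothesis applies. *)
    intros V' h' x z k'' l' Hk'' x' z'; simpl; unfold shift_mu; rewrite rename_rename.
    refine (IHV V' (lt_trans _ _ _ l' l) hU h' _ _ _ x z k'' _ _
              (good_rename _ _ _ _ _ Hk) Hk'' _ _); [|constructor].
    rewrite <- rename_sub; apply steps_rename; eapply steps_trans; eauto.
Qed.

Lemma good_nil U h : good U h (fun _ => []).
Proof.
  apply good_unfold; intros; simpl; eapply good_sub_SN; eauto.
Qed.

(** The empty substitution is the identity and is good, so [good_App] settles applications. *)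
Lemma SN_term M : SN M.
Proof.
  induction M as [x|M IH|M IHM N IHN|M IH|a M IH].
  - apply SN_Var.
  - now apply SN_Lam.
  - eapply (good_App M N (SN_Acc_lt _ IHM) (SN_Acc_lt _ IHN));
      try apply good_nil; rewrite sub_id; constructor.
  - now apply SN_Mu.
  - now apply SN_Named.
Qed.

Theorem theorem4p6 : forall M : term, strongly_normalizing step M.
Proof.
  intros M (f & H0 & Hf).
  (* An accessible term never occurs in [f]: the next term of the sequence would violate the
     induction hypothesis. *)
  assert (E : forall N, SN N -> forall n, f n <> N).
  { induction 1 as [N _ IH]; intros n <-; exact (IH _ (Hf n) (S n) eq_refl). }
  exact (E M (SN_term M) 0 H0).
Qed.
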